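(* There exists an algorithm that multiplies two $\sqrt{n}\times\sqrt{n}$ matrices in the $(m,\ell)$-TCU model in time $$T(n)=\Theta\!\left(\frac{n^{3/2}}{m^{1/2}}+\frac{n}{m}\ell\right).$$ Moreover, this is optimal when only semiring operations are allowed: any algorithm in the $(m,\ell)$-TCU model (whose tensor unit computes products via the standard $\Theta(m^{3/2})$ elementary products per $\sqrt{m}\times\sqrt{m}$ block) that multiplies two $\sqrt{n}\times\sqrt{n}$ matrices using only semiring operations requires $\Omega\!\left(\frac{n^{3/2}}{m^{1/2}}+\frac{n}{m}\ell\right)$ time.
   Context: The $(m,\ell)$-TCU model (parameters $m\ge 1$, $\ell\ge 0$) is the standard RAM model whose CPU additionally contains a tensor unit: by a constant-size instruction specifying the memory addresses of the operands and of the output, the unit multiplies an $N\times\sqrt{m}$ matrix $A$ by a $\sqrt{m}\times\sqrt{m}$ matrix $B$ (where $N\geq\sqrt{m}$ is a value chosen by the algorithm) and writes $A\cdot B$ to memory, at a cost of $O(N\sqrt{m}+\ell)$ time. The tensor unit implements the standard (non-fast, e.g. systolic) matrix multiplication. The running time of an algorithm is the total cost of all operations performed, including all calls to the tensor unit; the tensor unit, memory and CPU never operate concurrently.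
   Formalization: The upper bound is stated for n ≥ m; the lower bound assumes ℓ ≤ m√n or that all elementary products are done by the tensor unit, and correctness over a semiring containing the naturals. Without these the claim fails (e.g. the plain CPU algorithm never pays ℓ). *)

(* Defs.v *)
From HB Require Import structures.
From mathcomp Require Import all_boot all_order all_algebra.
From mathcomp Require Import reals.

Set Implicit Arguments.
Unset Strict Implicit.
Unset Printing Implicit Defensive.

Import Order.TTheory GRing.Theory Num.Theory.
Local Open Scope ring_scope.

(* The (m, l)-TCU machine with m = q ^ 2: a random access machine over an
   algebra R of scalars. Its memory has a bank of words (natural numbers, used
   for addresses and control) and a bank of scalars. A program is a list of
   instructions; it halts when the program counter leaves the list.

   Notation below: w is the word bank, d the scalar bank. Every operand of an
   instruction is the (constant) address of a word; scalars are therefore always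
   addressed indirectly. *)

Inductive word_op := WAdd | WSub | WMul | WDiv.

Inductive instr :=
| WConst  of nat & nat                   (* w[a] := k *)
| WOp     of word_op & nat & nat & nat   (* w[a] := w[x] op w[y] *)
| WLoad   of nat & nat                   (* w[a] := w[w[x]] *)
| WStore  of nat & nat                   (* w[w[a]] := w[x] *)
| Jump    of nat                         (* goto k *)
| JumpLt  of nat & nat & nat             (* if w[x] < w[y] goto k *)
| SZero   of nat                         (* d[w[a]] := 0 *)
| SOne    of nat                         (* d[w[a]] := 1 *)
| SCopy   of nat & nat                   (* d[w[a]] := d[w[x]] *)
| SAdd    of nat & nat & nat             (* d[w[a]] := d[w[x]] + d[w[y]] *)
| SMul    of nat & nat & nat             (* d[w[a]] := d[w[x]] * d[w[y]] *)
  (* In the next four the first argument selects one of the CPU's scalar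
     operations that are not semiring operations; see [scalar_ext]. *)
| XOp     of nat & nat & nat & nat       (* d[w[a]] := op d[w[x]] d[w[y]] *)
| XTest   of nat & nat & nat & nat       (* if test d[w[x]] d[w[y]] goto k *)
| XToWord of nat & nat & nat             (* w[a] := to_word d[w[x]] *)
| XOfWord of nat & nat & nat             (* d[w[a]] := of_word w[x] *)
  (* Tensor N x y z: the w[N] x q matrix at d[w[x]] times the q x q matrix at
     d[w[y]], written at d[w[z]]. *)
| Tensor  of nat & nat & nat & nat.

Definition program := seq instr.

(* An interpretation of the scalar operations of the CPU other than those of a
   semiring: subtraction, division, comparisons, conversions, and so on. *)
Record scalar_ext (R : Type) := ScalarExt {
  ext_op      : nat -> R -> R -> R;
  ext_test    : nat -> R -> R -> bool;
  ext_to_word : nat -> R -> nat;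
  ext_of_word : nat -> nat -> R }.

Definition is_semiring_instr (i : instr) : bool :=
  match i with
  | XOp _ _ _ _ | XTest _ _ _ _ | XToWord _ _ _ | XOfWord _ _ _ => false
  | _ => true
  end.

Definition is_scalar_mul (i : instr) : bool :=
  if i is SMul _ _ _ then true else false.

Definition semiring_only (p : program) : bool := all is_semiring_instr p.

(* All elementary products are left to the tensor unit. *)
Definition tensor_products_only (p : program) : bool :=
  ~~ has is_scalar_mul p.

Record config (R : Type) := Config {
  pc      : nat;
  words   : nat -> nat;
  scalars : nat -> R }.

Definition upd (T : Type) (f : nat -> T) (a : nat) (v : T) : nat -> T :=
  fun x => if x == a then v else f x.

(* Matrices are stored contiguously, in row-major order. *)
Definition load_mx (R : Type) (h v : nat) (d : nat -> R) (a : nat) :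
    'M[R]_(h, v) :=
  \matrix_(i < h, j < v) d (a + i * v + j)%N.

Definition store_mx (R : Type) (h v : nat) (d : nat -> R) (a : nat)
    (M : 'M[R]_(h, v)) : nat -> R :=
  fun x => if [pick ij : 'I_h * 'I_v | x == a + ij.1 * v + ij.2]%N is Some ij
           then M ij.1 ij.2 else d x.

Definition eval_word_op (o : word_op) : nat -> nat -> nat :=
  match o with
  | WAdd => addn | WSub => subn | WMul => muln | WDiv => divn
  end.

Section Machine.
Variables (K : realType) (q : nat) (l : K).
Variables (R : pzSemiRingType) (X : scalar_ext R).

(* None is a fault: the tensor unit requires at least q rows on the left. *)
Definition exec (i : instr) (c : config R) : option (config R) :=
  let w := words c in
  let d := scalars c in
  let setw a v := Some (Config (pc c).+1 (upd w a v) d) in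
  let sets a v := Some (Config (pc c).+1 w (upd d (w a) v)) in
  let goto b k := Some (Config (if b then k else (pc c).+1) w d) in
  match i with
  | WConst a k => setw a k
  | WOp o a x y => setw a (eval_word_op o (w x) (w y))
  | WLoad a x => setw a (w (w x))
  | WStore a x => setw (w a) (w x)
  | Jump k => goto true k
  | JumpLt x y k => goto (w x < w y)%N k
  | SZero a => sets a 0
  | SOne a => sets a 1
  | SCopy a x => sets a (d (w x))
  | SAdd a x y => sets a (d (w x) + d (w y))
  | SMul a x y => sets a (d (w x) * d (w y))
  | XOp o a x y => sets a (ext_op X o (d (w x)) (d (w y)))
  | XTest o x y k => goto (ext_test X o (d (w x)) (d (w y))) k
  | XToWord o a x => setw a (ext_to_word X o (d (w x)))
  | XOfWord o a x => sets a (ext_of_word X o (w x))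
  | Tensor N x y z =>
      if (q <= w N)%N then
        Some (Config (pc c).+1 w
          (store_mx d (w z)
             (load_mx (w N) q d (w x) *m load_mx q q d (w y))))
      else None
  end.

Definition cost (i : instr) (c : config R) : K :=
  if i is Tensor N _ _ _ then (words c N * q)%:R + l else 1.

(* run p c t c': started in c, the program p halts in c' after time t. *)
Inductive run (p : program) : config R -> K -> config R -> Prop :=
| run_halt c of (size p <= pc c)%N : run p c 0 c
| run_step i c c' t c'' of onth p (pc c) = Some i & exec i c = Some c' &
    run p c' t c'' : run p c (cost i c + t) c''.

(* With n = s ^ 2: the words 0 and 1 hold s and q, the operands are at the
   scalar addresses 0 and n, and everything else is 0. *)
Definition init_config (s : nat) (A B : 'M[R]_s) : config R :=
  Config 0
    (fun x => if x == 0%N then s else if x == 1%N then q else 0%N)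
    (store_mx (store_mx (fun=> 0) 0 A) (s ^ 2) B).

(* On input A, B the program p halts after time t with A *m B at 2 n. *)
Definition multiplies_in (p : program) (s : nat) (A B : 'M[R]_s) (t : K) :
    Prop :=
  exists2 c, run p (init_config A B) t c &
             load_mx s s (scalars c) (2 * s ^ 2)%N = A *m B.

Definition multiplies (p : program) (s : nat) : Prop :=
  forall A B : 'M[R]_s, exists t, multiplies_in p A B t.

End Machine.

(* n^(3/2) / m^(1/2) + (n / m) l *)
Definition tcu_bound (K : realType) (n m : nat) (l : K) : K :=
  Num.sqrt n%:R ^+ 3 / Num.sqrt m%:R + n%:R / m%:R * l.

(* Main.v *)
Require Import Defs.
From HB Require Import structures.
From mathcomp Require Import all_boot all_order all_algebra.
From mathcomp Require Import boolp reals.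
From mathcomp Require Import zify lra ring.

(* Lower bound. The control flow of a program that uses only semiring operations
   does not depend on the scalars, so the program can be run, in the same time,
   over the semiring of languages on the letters a_ij, b_jk, where each cell
   holds the set of monomials of the polynomial it contains. Since the naturals
   embed in R and nothing cancels, the output cell (i, k) must hold exactly the
   monomials a_ij b_jk. Such a monomial, in a cell that can still contribute to
   an output, was created by an elementary product whose factors are the letters
   a_ij and b_jk alone. Hence every elementary product accounts for at most one
   of the s^3 triples (i, j, k), and a call of the tensor unit for at most
   q^2 min (N, s) of them, as each of the q^2 entries of its right operand fixes
   two of the three indices.

   Upper bound. Cut the matrices into column strips of width q, padded with
   zeros, multiply every strip of A (with all its s rows) by every q x q block of
   B, and add up the partial products. *)

Set Implicit Arguments.
Unset Strict Implicit.
Unset Printing Implicit Defensive.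

Import Order.TTheory GRing.Theory Num.Theory.
Local Open Scope ring_scope.

(** * Runs *)

Lemma all_onth (T : Type) (a : pred T) s n x : all a s -> onth s n = Some x -> a x.
Proof.
elim: s n => [|y s IH] [|n] //= /andP[ay as_]; first by case=> <-.
exact: IH.
Qed.

Section Determinism.
Variables (K : realType) (q : nat) (l : K) (R : pzSemiRingType).
Variables (X : scalar_ext R) (p : program).

(** Determinism identifies a run transferred from another semiring with the run that [multiplies]
    provides. *)
Lemma run_inj c t1 c1 t2 c2 :
  run q l X p c t1 c1 -> run q l X p c t2 c2 -> t1 = t2 /\ c1 = c2.
Proof.
move=> r1; elim: r1 t2 c2 => {c t1 c1}
    [c hc|i c c' t c'' hi he _ IH] t2 c2 r2.
  case: {c t2 c2} _ _ _ / r2 hc => // i c c' t c'' hi _ _ hc.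
  by rewrite onth_default in hi.
case: {c t2 c2} _ _ _ / r2 hi he => [c hc|j c d u d'' hj hd r2] hi he.
  by rewrite onth_default in hi.
move: hj hd; rewrite hi => -[<-]; rewrite he => -[ed]; rewrite -ed in r2.
by have [-> ->] := IH _ _ r2.
Qed.

End Determinism.

(** * Independence of the control flow from the scalars *)

Section Parametricity.
Variables (K : realType) (q : nat) (l : K) (R S : pzSemiRingType).
Variables (X : scalar_ext R) (Y : scalar_ext S) (rel : R -> S -> Prop).
Hypotheses (rel0 : rel 0 0) (rel1 : rel 1 1).
Hypothesis relD : forall x x' y y', rel x x' -> rel y y' -> rel (x + y) (x' + y').
Hypothesis relM : forall x x' y y', rel x x' -> rel y y' -> rel (x * y) (x' * y').

Let relf (d : nat -> R) (d' : nat -> S) := forall x, rel (d x) (d' x).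

Lemma rel_upd d d' a v v' : relf d d' -> rel v v' -> relf (upd d a v) (upd d' a v').
Proof. by move=> hd hv x; rewrite /upd; case: ifP. Qed.

Lemma rel_store_mx h v d d' a (M : 'M[R]_(h, v)) (N : 'M[S]_(h, v)) :
  relf d d' -> (forall i j, rel (M i j) (N i j)) ->
  relf (store_mx d a M) (store_mx d' a N).
Proof. by move=> hd hM x; rewrite /store_mx; case: pickP. Qed.

Lemma rel_mulmx h v u (M : 'M[R]_(h, v)) (N : 'M[R]_(v, u))
    (M' : 'M[S]_(h, v)) (N' : 'M[S]_(v, u)) :
  (forall i j, rel (M i j) (M' i j)) -> (forall i j, rel (N i j) (N' i j)) ->
  forall i j, rel ((M *m N) i j) ((M' *m N') i j).
Proof.
move=> hM hN i j; rewrite !mxE.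
by apply: (big_ind2 rel) => // k _; apply: relM.
Qed.

(** Without the four [X] instructions scalars never influence words, addresses or jumps; they are
    only copied, added, multiplied, or set to 0 or 1. *)
Lemma exec_rel i pc0 w d d' c : is_semiring_instr i -> relf d d' ->
  exec q X i (Config pc0 w d) = Some c ->
  exists2 e, relf (scalars c) e &
    exec q Y i (Config pc0 w d') = Some (Config (pc c) (words c) e).
Proof.
case: i => //=; try by move=> *; match goal with H : Some _ = Some _ |- _ =>
  case: H => <- /= end; eexists; last reflexivity; rewrite //; apply: rel_upd;
  rewrite //; (apply: relD || apply: relM).
move=> N x y z _ hd; case: ifP => // _ [<-] /=; eexists; last reflexivity.
by apply: rel_store_mx => //; apply: rel_mulmx => i j; rewrite !mxE.
Qed.

Lemma run_rel p c t c' d : semiring_only p -> relf (scalars c) d ->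
  run q l X p c t c' ->
  exists2 e, relf (scalars c') e &
    run q l Y p (Config (pc c) (words c) d) t (Config (pc c') (words c') e).
Proof.
move=> hp hd r; elim: r d hd => {c t c'} [c hc|i c c' t c'' hi he _ IH] d hd.
  by exists d => //; apply: run_halt.
have si : is_semiring_instr i := all_onth hp hi.
case: c hd hi he => pc0 w d0 /= hd hi he.
have [e he1 he2] := exec_rel si hd he.
have [e' h1 h2] := IH _ he1; exists e' => //.
(* The cost reads the words only, so both runs take the same time. *)
have -> : cost q l i (Config pc0 w d0) = cost q l i (Config pc0 w d).
  by case: (i).
exact: (run_step _ he2).
Qed.

Lemma init_config_rel s (A B : 'M[R]_s) (A' B' : 'M[S]_s) :
  (forall i j, rel (A i j) (A' i j)) -> (forall i j, rel (B i j) (B' i j)) ->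
  relf (scalars (init_config q A B)) (scalars (init_config q A' B')).
Proof. by move=> hA hB; do 2!apply: rel_store_mx => //. Qed.

Lemma run_init_rel p s (A B : 'M[R]_s) (A' B' : 'M[S]_s) t c :
  semiring_only p ->
  (forall i j, rel (A i j) (A' i j)) -> (forall i j, rel (B i j) (B' i j)) ->
  run q l X p (init_config q A B) t c ->
  exists2 e, relf (scalars c) e &
    run q l Y p (init_config q A' B') t (Config (pc c) (words c) e).
Proof. by move=> hp hA hB; apply: run_rel => //; apply: init_config_rel. Qed.

End Parametricity.

(** * The semiring of languages *)

(** Words serve as noncommutative monomials. Addition will be union and product concatenation, so
    coefficients are forgotten and nothing cancels. *)
Definition lang (T : Type) := seq T -> Prop.

Section LangSemiring.
Variable T : Type.

HB.instance Definition _ := gen_eqMixin (lang T).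
HB.instance Definition _ := gen_choiceMixin (lang T).

Definition lang0 : lang T := fun=> False.
Definition lang1 : lang T := fun w => w = [::].
Definition lang_add (U V : lang T) : lang T := fun w => U w \/ V w.
Definition lang_mul (U V : lang T) : lang T :=
  fun w => exists u v, [/\ U u, V v & w = u ++ v].

Lemma langP (U V : lang T) : (forall w, U w <-> V w) -> U = V.
Proof. by move=> h; apply/funext => w; apply/propext. Qed.

Lemma lang_addA : associative lang_add.
Proof. by move=> U V W; apply: langP => w; rewrite /lang_add; tauto. Qed.
Lemma lang_addC : commutative lang_add.
Proof. by move=> U V; apply: langP => w; rewrite /lang_add; tauto. Qed.
Lemma lang_add0 : left_id lang0 lang_add.
Proof. by move=> U; apply: langP => w; rewrite /lang_add /lang0; tauto. Qed.

HB.instance Definition _ :=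
  GRing.isNmodule.Build (lang T) lang_addA lang_addC lang_add0.

Lemma lang_mulA : associative lang_mul.
Proof.
move=> U V W; apply: langP => w; split.
  move=> [u [_ [hu [v [x [hv hx ->]]] ->]]]; exists (u ++ v), x.
  by rewrite catA; split=> //; exists u, v.
move=> [_ [x [[u [v [hu hv ->]]] hx ->]]]; exists u, (v ++ x).
by rewrite catA; split=> //; exists v, x.
Qed.
Lemma lang_mul1 : left_id lang1 lang_mul.
Proof.
move=> U; apply: langP => w; split; first by move=> [_ [v [-> hv ->]]].
by move=> hw; exists [::], w.
Qed.
Lemma lang_mulr1 : right_id lang1 lang_mul.
Proof.
move=> U; apply: langP => w; split; first by move=> [u [_ [hu -> ->]]]; rewrite cats0.
by move=> hw; exists w, [::]; rewrite cats0.
Qed.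
Lemma lang_mulDl : left_distributive lang_mul lang_add.
Proof.
move=> U V W; apply: langP => w; split.
  by move=> [u [v [[hu|hu] hv ->]]]; [left|right]; exists u, v.
by move=> [] [u [v [hu hv ->]]]; exists u, v; split=> //; [left|right].
Qed.
Lemma lang_mulDr : right_distributive lang_mul lang_add.
Proof.
move=> U V W; apply: langP => w; split.
  by move=> [u [v [hu [hv|hv] ->]]]; [left|right]; exists u, v.
by move=> [] [u [v [hu hv ->]]]; exists u, v; split=> //; [left|right].
Qed.
Lemma lang_mul0 : left_zero lang0 lang_mul.
Proof. by move=> U; apply: langP => w; split=> // -[u [v []]]. Qed.
Lemma lang_mulr0 : right_zero lang0 lang_mul.
Proof. by move=> U; apply: langP => w; split=> // -[u [v []]]. Qed.

HB.instance Definition _ := GRing.Nmodule_isPzSemiRing.Build (lang T)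
  lang_mulA lang_mul1 lang_mulr1 lang_mulDl lang_mulDr lang_mul0 lang_mulr0.

End LangSemiring.

(** Think of [r] as the value at [rho] of a polynomial with natural coefficients whose monomials are
    the words of [V]. The two conditions on [n] are what remains when the coefficients are
    forgotten; they survive sums and products. *)
Definition approx (R : pzSemiRingType) (T : Type) (rho : T -> nat) (r : R)
    (V : lang T) : Prop :=
  exists n : nat, [/\ r = n%:R,
    forall w, V w -> (\prod_(x <- w) rho x <= n)%N &
    n <> 0%N -> exists2 w, V w & (\prod_(x <- w) rho x)%N <> 0%N].

Section Approx.
Variables (R : pzSemiRingType) (T : Type) (rho : T -> nat).
Notation apx := (@approx R T rho).

Lemma approx0 : apx 0 0.
Proof. by exists 0%N; split. Qed.

Lemma approx1 : apx 1 1.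
Proof.
exists 1%N; split=> // [w ->|_]; first by rewrite big_nil.
by exists [::] => //; rewrite big_nil.
Qed.

Lemma approxD r U r' V : apx r U -> apx r' V -> apx (r + r') (U + V).
Proof.
move=> [n [-> n1 n2]] [m [-> m1 m2]]; exists (n + m)%N; split.
- by rewrite natrD.
- by move=> w [/n1|/m1]; lia.
- case: (n =P 0%N) => [->|/n2 [w hw h] _]; last by exists w => //; left.
  by move=> /m2 [w hw h]; exists w => //; right.
Qed.

Lemma approxM r U r' V : apx r U -> apx r' V -> apx (r * r') (U * V).
Proof.
move=> [n [-> n1 n2]] [m [-> m1 m2]]; exists (n * m)%N; split.
- by rewrite natrM.
- by move=> w [u [v [/n1 hu /m1 hv ->]]]; rewrite big_cat leq_mul.
- move=> h; have [|u hu u0] := n2; first by move=> n0; apply: h; rewrite n0.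
  have [|v hv v0] := m2; first by move=> m0; apply: h; rewrite m0 muln0.
  by exists (u ++ v); [exists u, v | rewrite big_cat /=; nia].
Qed.

End Approx.

(** * Charging the terms of the product to the elementary products *)

Section Coverage.
Variable s : nat.

Definition var := (('I_s * 'I_s) + ('I_s * 'I_s))%type.
Definition va (i j : 'I_s) : var := inl (i, j).
Definition vb (j k : 'I_s) : var := inr (j, k).
Definition triple := ('I_s * 'I_s * 'I_s)%type.

(** Both orders are needed: evaluations at natural numbers commute and cannot tell them apart. *)
Definition term_word (i j k : 'I_s) (w : seq var) : Prop :=
  w = [:: va i j; vb j k] \/ w = [:: vb j k; va i j].

Definition within (i k : 'I_s) (V : lang var) : Prop :=
  forall w, V w -> exists j, term_word i j k w.

Definition has_term (V : lang var) (i j k : 'I_s) : Prop :=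
  exists2 w, V w & term_word i j k w.

Definition charged (U V : lang var) (u : triple) : Prop :=
  let: (i, j, k) := u in within i k (U * V) /\
    (U [:: va i j] /\ V [:: vb j k] \/ U [:: vb j k] /\ V [:: va i j]).

(** The invariant of a run, [Z] being the set of triples paid for so far. A cell containing a word
    foreign to the output entry (i, k) is exempt for that entry. *)
Definition covered (Z : {set triple}) (V : lang var) : Prop :=
  forall i j k, within i k V -> has_term V i j k -> (i, j, k) \in Z.

Lemma within_mul i k U V u v : within i k (U * V) -> U u -> V v ->
  exists j, u ++ v = [:: va i j; vb j k] \/ u ++ v = [:: vb j k; va i j].
Proof. by move=> h hu hv; apply: h; exists u, v. Qed.

(** A letter of [U] used by one triple and a letter of [V] used by the other also form a word of the
    product. This word must be a term of the output entry, which forces the indices to agree and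
    excludes two letters of the same matrix. *)
Lemma charged_uniq U V u u' : charged U V u -> charged U V u' -> u = u'.
Proof.
case: u u' => [[i j] k] [[i' j'] k'] [h1 h2] [h1' h2'].
case: h2 h2' => [[a b]|[b a]] [[a' b']|[b' a']].
- case: (within_mul h1 a b') => x [] //= -[] *; subst.
  by case: (within_mul h1' a b') => y [] //= -[] *; subst.
- by case: (within_mul h1 a a') => x [].
- by case: (within_mul h1 b b') => x [].
- case: (within_mul h1 b a') => x [] //= -[] *; subst.
  by case: (within_mul h1' b a') => y [] //= -[] *; subst.
Qed.

Definition charged_set (U V : lang var) : {set triple} :=
  [set u | `[< charged U V u >]].

Lemma charged_setP U V u : reflect (charged U V u) (u \in charged_set U V).
Proof. by rewrite inE; apply: asboolP. Qed.

Lemma card_charged_set U V : (#|charged_set U V| <= 1)%N.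
Proof.
apply/card_le1P => u /charged_setP hu v; rewrite [RHS]inE.
apply/idP/eqP => [/charged_setP hv|->]; last exact/charged_setP.
exact: charged_uniq hv hu.
Qed.

Lemma card_bigcup_le (I J : finType) (F : I -> {set J}) :
  (#|\bigcup_i F i| <= \sum_i #|F i|)%N.
Proof.
elim/big_rec2: _ => [|i n A _ h]; first by rewrite cards0.
by rewrite (leq_trans (leq_card_setU _ _)) // leq_add2l.
Qed.

(* The right factor is a single entry, which fixes two of the three indices. *)
Lemma card_charged_column h (F : 'I_h -> lang var) V :
  (#|\bigcup_r charged_set (F r) V| <= minn h s)%N.
Proof.
rewrite leq_min; apply/andP; split.
  apply: leq_trans (card_bigcup_le _) _.
  rewrite -[X in (_ <= X)%N]card_ord -sum1_card leq_sum // => r _.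
  exact: card_charged_set.
set Z := \bigcup_r _.
have [->|[u0 /bigcupP[r0 _ /charged_setP c0]]] := set_0Vmem Z; first by rewrite cards0.
case: u0 c0 => [[i0 j0] k0] [h0 [[a0 b0]|[b0 a0]]].
(* If [V] contains the letter b of u0, only i is free; in the other case [V] contains its letter a
   and only k is free. *)
- apply: (@leq_trans #|[set (i, j0, k0) | i : 'I_s]|); last first.
    by rewrite (leq_trans (leq_imset_card _ _)) // card_ord.
  apply/subset_leq_card/subsetP => -[[i j] k] /bigcupP[r _ /charged_setP[h1 h2]].
  case: h2 => [[a b]|[b a]].
    case: (within_mul h1 a b0) => x [] //= -[] *; subst.
    by apply/imsetP; exists i.
  by case: (within_mul h1 b b0) => x [].
- apply: (@leq_trans #|[set (i0, j0, k) | k : 'I_s]|); last first.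
    by rewrite (leq_trans (leq_imset_card _ _)) // card_ord.
  apply/subset_leq_card/subsetP => -[[i j] k] /bigcupP[r _ /charged_setP[h1 h2]].
  case: h2 => [[a b]|[b a]].
    by case: (within_mul h1 a a0) => x [].
  case: (within_mul h1 b a0) => x [] //= -[] *; subst.
  by apply/imsetP; exists k.
Qed.

Lemma covered_sub (Y Z : {set triple}) V : Y \subset Z -> covered Y V -> covered Z V.
Proof. by move=> /subsetP h hV i j k hw ht; apply/h/hV. Qed.

(** Terms have length two, so constants and single letters are free of charge. *)
Lemma covered_short Z V : (forall w, V w -> (size w <= 1)%N) -> covered Z V.
Proof. by move=> h i j k _ [w /h hw [] hw']; rewrite hw' in hw. Qed.

Lemma covered0 Z : covered Z 0.
Proof. by apply: covered_short. Qed.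

Lemma covered1 Z : covered Z 1.
Proof. by apply: covered_short => w ->. Qed.

Lemma coveredD Z U V : covered Z U -> covered Z V -> covered Z (U + V).
Proof.
move=> hU hV i j k hw [w [hw1|hw1] ht].
- by apply: hU => [v hv|]; [apply: hw; left | exists w].
- by apply: hV => [v hv|]; [apply: hw; right | exists w].
Qed.

(** A term of length two splits as u ++ v. If u or v is empty, the term already lies in the other
    factor, which inherits [within]; otherwise both are single letters and the triple is charged. *)
Lemma coveredM Z U V : covered Z U -> covered Z V ->
  charged_set U V \subset Z -> covered Z (U * V).
Proof.
move=> hU hV /subsetP hZ i j k hw [w [u [v [hu hv ew]]] ht].
case: u hu ew => [|x [|y u]] hu ew.
- apply: hV; last by exists w; rewrite // ew.
  by move=> v' hv'; apply: hw; exists [::], v'.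
- apply/hZ/charged_setP; split=> //.
  by case: ht => ht; rewrite ht in ew; case: ew hu hv => <- <-; [left|right].
- have ev : v = [::] by case: ht ew => ->; case=> _ _; case: (u).
  rewrite {v}ev cats0 in hv ew.
  apply: hU; last by exists w; rewrite // ew.
  by move=> u' hu'; apply: hw; exists u', [::]; rewrite cats0.
Qed.

Lemma covered_store_mx Z h v d a (M : 'M[lang var]_(h, v)) :
  (forall x, covered Z (d x)) -> (forall i j, covered Z (M i j)) ->
  forall x, covered Z (store_mx d a M x).
Proof. by move=> hd hM x; rewrite /store_mx; case: pickP. Qed.

(** The elementary products are grouped by the entry of the right operand, ready for
    [card_charged_column]. *)
Lemma covered_mulmx Z h v (M : 'M[lang var]_(h, v)) (N : 'M[lang var]_v) :
  (forall i j, covered Z (M i j)) -> (forall i j, covered Z (N i j)) ->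
  \bigcup_(jk : 'I_v * 'I_v) \bigcup_r charged_set (M r jk.1) (N jk.1 jk.2)
    \subset Z ->
  forall i j, covered Z ((M *m N) i j).
Proof.
move=> hM hN hZ i k; rewrite mxE; apply: (big_ind (covered Z)).
- exact: covered0.
- exact: coveredD.
move=> j _; apply: coveredM => //; apply: subset_trans hZ.
by apply: (bigcup_max (j, k)) => //=; apply: (bigcup_max i).
Qed.

Lemma covered_upd Z (d : nat -> lang var) a v :
  (forall x, covered Z (d x)) -> covered Z v -> forall x, covered Z (upd d a v x).
Proof. by move=> hd hv x; rewrite /upd; case: ifP. Qed.

(** * The charge of one instruction and of a whole run *)

Section Step.
Variables (K : realType) (q : nat) (l : K) (X : scalar_ext (lang var)).
Hypotheses (q_gt0 : (0 < q)%N) (l_ge0 : 0 <= l).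

(** At l per triple, the latency of a tensor call pays for its at most q^2 s triples. A scalar
    multiplication costs 1 and pays for its single triple only when l <= q^2 s. *)
Definition latency_ok (p : program) : Prop :=
  tensor_products_only p \/ l <= (q ^ 2 * s)%:R.

Lemma cost_ge0 (R : pzSemiRingType) i (c : config R) : 0 <= cost q l i c.
Proof. by case: i => * /=; rewrite ?ler01 // addr_ge0. Qed.

Lemma exec_covered i c c' (Z : {set triple}) :
  is_semiring_instr i -> exec q X i c = Some c' ->
  (forall x, covered Z (scalars c x)) ->
  exists Y : {set triple}, [/\ forall x, covered (Z :|: Y) (scalars c' x),
    #|Y|%:R <= q%:R * cost q l i c &
    ~~ is_scalar_mul i \/ l <= (q ^ 2 * s)%:R ->
    l * #|Y|%:R <= (q ^ 2 * s)%:R * cost q l i c].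
Proof.
move=> si he hd.
(* Instructions other than products create no term, so nothing is charged. *)
have triv : (forall x, covered Z (scalars c' x)) ->
    exists Y : {set triple}, [/\ forall x, covered (Z :|: Y) (scalars c' x),
    #|Y|%:R <= q%:R * cost q l i c &
    ~~ is_scalar_mul i \/ l <= (q ^ 2 * s)%:R ->
    l * #|Y|%:R <= (q ^ 2 * s)%:R * cost q l i c].
  move=> h; exists set0; rewrite setU0 cards0 mulr0; split=> //.
    by rewrite mulr_ge0 // cost_ge0.
  by move=> _; rewrite mulr_ge0 // cost_ge0.
case: i si he triv => //=;
  try by move=> *; match goal with H : Some _ = Some _, T : _ -> exists _, _ |- _ =>
    apply: T; case: H => <- /=; rewrite //; apply: covered_upd => // end;
    auto using covered0, covered1, coveredD.
- move=> a x y _ [<-] /= _.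
  exists (charged_set (scalars c (words c x)) (scalars c (words c y))).
  have hZ z : covered (Z :|: charged_set (scalars c (words c x))
                             (scalars c (words c y))) (scalars c z).
    by apply: covered_sub (hd z); apply: subsetUl.
  split.
  + by apply: covered_upd => //; apply: coveredM => //; apply: subsetUr.
  + rewrite mulr1 ler_nat (leq_trans (card_charged_set _ _)) //.
  + move=> [//|hl]; rewrite mulr1; apply: le_trans hl.
    by rewrite ler_piMr // lern1 card_charged_set.
- move=> N x y z _ + _; case: ifP => // hN [<-] /=.
  set MA := load_mx _ _ _ _; set MB := load_mx _ _ _ _.
  set Y := \bigcup_(jk : 'I_q * 'I_q) \bigcup_r charged_set (MA r jk.1) (MB jk.1 jk.2).
  (* One column bound for each of the q^2 entries of the right operand. *)
  have cY : (#|Y| <= q * q * minn (words c N) s)%N.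
    apply: leq_trans (card_bigcup_le _) _.
    apply: (@leq_trans (\sum_(jk : 'I_q * 'I_q) minn (words c N) s)%N).
      by apply: leq_sum => jk _; apply: card_charged_column.
    by rewrite sum_nat_const card_prod !card_ord.
  exists Y.
  have hZ v : covered (Z :|: Y) (scalars c v).
    by apply: covered_sub (hd v); apply: subsetUl.
  split.
  + apply: covered_store_mx => //; apply: covered_mulmx; last exact: subsetUr.
    * by move=> i j; rewrite mxE.
    * by move=> i j; rewrite mxE.
  (* The minimum is bounded by the number of rows, paid for by the throughput term. *)
  + rewrite mulrDr -natrM; apply: le_trans (_ : (q * (words c N * q))%:R <= _).
      rewrite ler_nat (leq_trans cY) // (mulnC (words c N)) mulnA leq_mul2l.
      by rewrite geq_minl orbT.
    by rewrite lerDl mulr_ge0.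
  (* The minimum is bounded by s, paid for by the latency term. *)
  + move=> _; rewrite mulrC mulrDr; apply: le_trans (_ : (q ^ 2 * s)%:R * l <= _).
      rewrite ler_wpM2r // ler_nat (leq_trans cY) // -mulnn leq_mul2l.
      by rewrite geq_minr orbT.
    by rewrite lerDr mulr_ge0.
Qed.

Lemma run_covered p c t c' (Z : {set triple}) :
  semiring_only p -> run q l X p c t c' ->
  (forall x, covered Z (scalars c x)) ->
  exists Y : {set triple}, [/\ forall x, covered Y (scalars c' x),
    #|Y|%:R <= #|Z|%:R + q%:R * t &
    latency_ok p -> l * #|Y|%:R <= l * #|Z|%:R + (q ^ 2 * s)%:R * t].
Proof.
move=> hp r; elim: r Z => {c t c'} [c hc|i c c' t c'' hi he _ IH] Z hZ.
  by exists Z; rewrite !mulr0 !addr0.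
have [Y [h1 h2 h3]] := exec_covered (all_onth hp hi) he hZ.
have [W [k1 k2 k3]] := IH _ h1.
have cU : #|Z :|: Y|%:R <= #|Z|%:R + #|Y|%:R :> K.
  by rewrite -natrD ler_nat leq_card_setU.
exists W; split=> //.
  by rewrite mulrDr; lra.
move=> hl; apply: le_trans (k3 hl) _; rewrite mulrDr addrA lerD2r.
have {}h3 : l * #|Y|%:R <= (q ^ 2 * s)%:R * cost q l i c.
  apply: h3; case: hl => [hl|]; last by right.
  by left; apply: (all_onth (a := fun i => ~~ is_scalar_mul i) _ hi); rewrite all_predC.
apply: le_trans (_ : l * (#|Z|%:R + #|Y|%:R) <= _); first by rewrite ler_wpM2l.
by rewrite mulrDr lerD2l.
Qed.

End Step.
End Coverage.

(* Evaluating at [t] on the letters of [w] and at 0 elsewhere, with [t = 1],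
   shows that [w] contains a term; with [t > s], that it has length at most 2. *)
Lemma within_of_bound s (i k : 'I_s) (V : lang (var s)) :
  (forall rho w, V w ->
    \prod_(x <- w) rho x <= \sum_j rho (va i j) * rho (vb j k))%N ->
  within i k V.
Proof.
move=> hV w hw; pose rho t x := if x \in w then t else 0%N.
have prodE t : (\prod_(x <- w) rho t x)%N = (t ^ size w)%N.
  rewrite big_seq (eq_bigr (fun=> t)) => [|x xw]; last by rewrite /rho xw.
  by rewrite -big_seq big_const_seq count_predT iter_muln_1.
have h t := hV (rho t) _ hw.
have [j /andP[aw bw]] : exists j, (va i j \in w) && (vb j k \in w).
  apply/existsP; apply: contraLR (h 1%N); rewrite negb_exists => /forallP h1.
  rewrite prodE exp1n big1 // => j _.
  by move: (h1 j); rewrite /rho; do 2!case: ifP.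
exists j; have {}h : (size w <= 2)%N.
  rewrite leqNgt; apply/negP => w3; have := h s.+1; rewrite prodE.
  apply/negP; rewrite -ltnNge; apply: (@leq_trans (s.+1 ^ 3)); last first.
    exact: leq_pexp2l.
  apply: (@leq_ltn_trans (\sum_(j < s) s.+1 ^ 2)).
    apply: leq_sum => j' _; rewrite -mulnn leq_mul // /rho; by case: ifP.
  by rewrite sum_nat_const card_ord [ltnRHS]expnS ltn_mul2r expn_gt0 /=.
move: aw bw h; case: w {hw rho prodE} => [|x [|y [|]]] //.
  by rewrite !inE => /eqP <-.
by rewrite !inE => /orP[] /eqP <- /orP[] // /eqP <- _; [left|right].
Qed.

(** At the indicator of a_ij and b_jk the sum is nonzero, so [V] has a word in these two letters
    only; being a term, it is the one for j. *)
Lemma has_term_of_support s (i j k : 'I_s) (V : lang (var s)) :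
  within i k V ->
  (forall rho, (\sum_j rho (va i j) * rho (vb j k))%N <> 0%N ->
    exists2 w, V w & (\prod_(x <- w) rho x)%N <> 0%N) ->
  has_term V i j k.
Proof.
move=> hw hV; pose rho x := ((x == va i j) || (x == vb j k) : nat).
have [|w Vw /eqP w0] := hV rho.
  by rewrite (bigD1 j) //= /rho !eqxx orbT.
exists w => //; have [j' tw] := hw w Vw.
suff -> : j = j' by [].
case: tw w0 => ->; rewrite !big_cons big_nil muln1 muln_eq0 negb_or => /andP[h1 h2].
  by move: h1; rewrite /rho; case: (_ =P va i j) => [[->]|].
by move: h2; rewrite /rho; case: (_ =P va i j) => [[->]|].
Qed.

Definition trivial_ext (S : pzSemiRingType) : scalar_ext S :=
  ScalarExt (fun _ _ _ => 0) (fun _ _ _ => false) (fun _ _ => 0%N) (fun _ _ => 0).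

(** * The lower bound on the time *)

Section LowerBound.
Variables (K : realType) (q s : nat) (l : K) (R : pzSemiRingType).
Variables (X : scalar_ext R) (p : program).
Hypotheses (q_gt0 : (0 < q)%N) (l_ge0 : 0 <= l).
Hypothesis natr_inj : injective (fun k : nat => k%:R : R).
Hypothesis semi_p : semiring_only p.
Hypothesis mul_p : multiplies q l X p s.

Let LA : 'M[lang (var s)]_s := \matrix_(i, j) (fun w => w = [:: va i j]).
Let LB : 'M[lang (var s)]_s := \matrix_(i, j) (fun w => w = [:: vb i j]).

(** The run over languages is compared, for every [rho], with the run over [R] on the evaluated
    matrices, whose output is known because [p] multiplies. *)
Lemma output_lang t c (i k : 'I_s) (V := scalars c (2 * s ^ 2 + i * s + k)%N) :
  run q l (trivial_ext _) p (init_config q LA LB) t c ->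
  within i k V /\ forall j, has_term V i j k.
Proof.
move=> rL.
have key (rho : var s -> nat) : approx rho
    ((\sum_j rho (va i j) * rho (vb j k))%:R : R) V.
  pose A : 'M[R]_s := \matrix_(i, j) (rho (va i j))%:R.
  pose B : 'M[R]_s := \matrix_(i, j) (rho (vb i j))%:R.
  have hrho x : approx rho ((rho x)%:R : R) (fun w => w = [:: x]).
    exists (rho x); split=> // [w ->|h]; first by rewrite big_seq1.
    by exists [:: x]; rewrite // big_seq1.
  have [||e he rR] := run_init_rel (rel := fun V r => approx rho r V)
    (A' := A) (B' := B) X (approx0 _ _) (approx1 _ _)
    (fun _ _ _ _ => @approxD _ _ _ _ _ _ _) (fun _ _ _ _ => @approxM _ _ _ _ _ _ _)
    semi_p _ _ rL.
  - by move=> i' j'; rewrite !mxE.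
  - by move=> i' j'; rewrite !mxE.
  have [t' [c' rR' hc']] := mul_p A B.
  have [_ ec] := run_inj rR rR'.
  have := he (2 * s ^ 2 + i * s + k)%N; rewrite -/V.
  move: hc' => /matrixP /(_ i k); rewrite -ec !mxE /= => ->.
  rewrite natr_sum; under eq_bigr do rewrite !mxE -natrM.
  by [].
have hV rho : (forall w, V w ->
      \prod_(x <- w) rho x <= \sum_j rho (va i j) * rho (vb j k))%N /\
    ((\sum_j rho (va i j) * rho (vb j k))%N <> 0%N ->
      exists2 w, V w & (\prod_(x <- w) rho x)%N <> 0%N).
  (* Injectivity of the naturals in [R] identifies the number hidden in [approx] with the sum. *)
  by have [n [/natr_inj <- h1 h2]] := key rho.
have w_ik : within i k V by apply: within_of_bound => rho w /(proj1 (hV rho)).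
split=> // j; apply: has_term_of_support => // rho; exact: (proj2 (hV rho)).
Qed.

Lemma time_lower_bounds (A B : 'M[R]_s) t : multiplies_in q l X p A B t ->
  (s ^ 3)%:R <= q%:R * t /\
  (latency_ok s q l p -> l * (s ^ 3)%:R <= (q ^ 2 * s)%:R * t).
Proof.
move=> [c rR _].
(* The relation that always holds transfers halting and the time, whatever the input. *)
have [||||//|//|e _ rL] := run_init_rel (rel := fun _ _ => True)
   (A' := LA) (B' := LB) (trivial_ext _) _ _ _ _ semi_p _ _ rR; rewrite //.
have [|Y [hY h1 h2]] := @run_covered s K q l _ q_gt0 l_ge0 _ _ _ _ set0 semi_p rL.
  apply: covered_store_mx; first apply: covered_store_mx.
  - by move=> x; apply: covered0.
  - by move=> i j; apply: covered_short => w; rewrite mxE => ->.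
  - by move=> i j; apply: covered_short => w; rewrite mxE => ->.
have YT : Y = setT.
  apply/setP => -[[i j] k]; rewrite [RHS]inE.
  have [h3 h4] := output_lang i k rL.
  exact: (hY _ _ _ _ h3 (h4 j)).
have cY : #|Y| = (s ^ 3)%N.
  by rewrite YT cardsT !card_prod !card_ord !expnS muln1 mulnA.
by move: h1 h2; rewrite cY cards0 mulr0n mulr0 !add0r.
Qed.

Lemma tcu_boundE : tcu_bound (s ^ 2) (q ^ 2) l =
  (s ^ 3)%:R / q%:R + (s ^ 2)%:R / (q ^ 2)%:R * l.
Proof. by rewrite /tcu_bound !natrX !sqrtr_sqr !ger0_norm. Qed.

(** Each of the two summands of the bound is at most t, hence so is half their sum. *)
Lemma tcu_lower_bound (A B : 'M[R]_s) t :
  tensor_products_only p \/ l <= (q ^ 2)%:R * Num.sqrt (s ^ 2)%:R ->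
  multiplies_in q l X p A B t -> 2^-1 * tcu_bound (s ^ 2) (q ^ 2) l <= t.
Proof.
move=> hl /time_lower_bounds[h1 h2].
have {h2}/h2 : latency_ok s q l p.
  case: hl => [|hl]; [by left | right].
  by rewrite natrM; move: hl; rewrite (natrX _ s) sqrtr_sqr ger0_norm.
have q0 : 0 < q%:R :> K by rewrite ltr0n.
(* For s = 0 the bound vanishes and [h1] gives t >= 0; otherwise s can be cancelled. *)
rewrite tcu_boundE; move: h1; have [-> h1 _|s_gt0 h1 h2] := posnP s.
  rewrite !exp0n // !mul0r addr0 mulr0; rewrite exp0n // in h1.
  by rewrite -(pmulr_rge0 _ q0).
have {}h1 : (s ^ 3)%:R / q%:R <= t by rewrite ler_pdivrMr // mulrC.
have {}h2 : (s ^ 2)%:R / (q ^ 2)%:R * l <= t.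
  rewrite mulrAC ler_pdivrMr ?ltr0n ?expn_gt0 ?q_gt0 //.
  have s0 : 0 < s%:R :> K by rewrite ltr0n.
  rewrite -(ler_pM2r s0); move: h2; rewrite (natrM _ (q ^ 2)) !natrX; lra.
lra.
Qed.

End LowerBound.

(** * The blocked algorithm *)

Definition word_code := seq (word_op * nat * nat * nat).

Definition word_instrs (ops : word_code) : program :=
  [seq WOp i.1.1.1 i.1.1.2 i.1.2 i.2 | i <- ops].

(* Registers: 0: s, 1: q, 2: b = ceil (s / q), 3: s^2, 4, 5, 6, 7: the addresses
   of the product, of the strips of A and of B, and of the partial products,
   8: loop counter, 9: loop bound, 10: 1, 11: size of a strip, 12: q^2. *)
Definition setup_ops : word_code := [::
  (WAdd, 2, 0, 1); (WSub, 2, 2, 10); (WDiv, 2, 2, 1); (WMul, 3, 0, 0);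
  (WAdd, 4, 3, 3); (WAdd, 5, 4, 3); (WMul, 12, 1, 1); (WMul, 11, 2, 12);
  (WMul, 13, 2, 11); (WAdd, 6, 5, 13); (WAdd, 7, 6, 13)]%N.

(** The counter is a row-major index x; its row and column are decoded and turned into the offset
    [enc]. Registers from 13 on are scratch. *)
Definition strip_ops1 : word_code := [::
  (WDiv, 13, 8, 0); (WMul, 14, 13, 0); (WSub, 14, 8, 14); (WDiv, 15, 14, 1);
  (WMul, 16, 15, 1); (WSub, 16, 14, 16); (WMul, 15, 15, 11); (WMul, 13, 13, 1);
  (WAdd, 13, 15, 13); (WAdd, 13, 13, 16); (WAdd, 14, 5, 13)]%N.

Definition strip_ops2 : word_code := [:: (WAdd, 14, 6, 13); (WAdd, 15, 3, 8)]%N.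

Definition incr_ops : word_code := [:: (WAdd, 8, 8, 10)]%N.

(** The counter is y = J b + k: strip J of A meets block J of strip k of B, and the result goes to
    slot y. *)
Definition tensor_ops : word_code := [::
  (WDiv, 13, 8, 2); (WMul, 14, 13, 2); (WSub, 14, 8, 14); (WMul, 15, 13, 11);
  (WAdd, 15, 5, 15); (WMul, 14, 14, 11); (WMul, 13, 13, 12); (WAdd, 14, 14, 13);
  (WAdd, 14, 6, 14); (WMul, 16, 8, 11); (WAdd, 16, 7, 16)]%N.

(** The counter is y = x b + J: output cell x receives its J-th summand from slot J b + (x mod s) /
    q. *)
Definition sum_ops : word_code := [::
  (WDiv, 13, 8, 2); (WMul, 14, 13, 2); (WSub, 14, 8, 14); (WDiv, 15, 13, 0);
  (WMul, 16, 15, 0); (WSub, 16, 13, 16); (WDiv, 17, 16, 1); (WMul, 18, 17, 1);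
  (WSub, 16, 16, 18); (WMul, 14, 14, 2); (WAdd, 14, 14, 17); (WMul, 14, 14, 11);
  (WMul, 15, 15, 1); (WAdd, 14, 14, 15); (WAdd, 14, 14, 16); (WAdd, 14, 7, 14);
  (WAdd, 13, 4, 13)]%N.

(** The loops start at 12, 31 and 47, test their counter after the body, and the program leaves at
    67. Zero padding, the empty output and the first value of the counter come from the initial
    memory. *)
Definition block_mul : program :=
  WConst 10 1 :: word_instrs setup_ops
  ++ word_instrs strip_ops1 ++ SCopy 14 8 :: word_instrs strip_ops2
  ++ SCopy 14 15 :: word_instrs incr_ops ++ [:: JumpLt 8 3 12]
  ++ WConst 8 0 :: WOp WMul 9 2 2
  :: word_instrs tensor_ops ++ Tensor 0 15 14 16 :: word_instrs incr_ops
  ++ [:: JumpLt 8 9 31]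
  ++ WConst 8 0 :: WOp WMul 9 3 2
  :: word_instrs sum_ops ++ SAdd 13 13 14 :: word_instrs incr_ops
  ++ [:: JumpLt 8 9 47].

Definition exec_words (ops : word_code) (w : nat -> nat) : nat -> nat :=
  foldl (fun w i => upd w i.1.1.2 (eval_word_op i.1.1.1 (w i.1.2) (w i.2))) w ops.

Lemma subn_divn x v : (x - x %/ v * v = x %% v)%N.
Proof. by rewrite {1}(divn_eq x v) addKn. Qed.

Lemma divmod_inj v x x' y y' : (y < v)%N -> (y' < v)%N ->
  (x * v + y = x' * v + y')%N -> x = x' /\ y = y'.
Proof.
move=> hy hy' e; have v0 : (0 < v)%N by apply: leq_ltn_trans hy.
have := congr1 (divn^~ v) e; rewrite !divnMDl // !divn_small // !addn0 => ex.
by move: e; rewrite ex => /addnI.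
Qed.

Lemma row_lt v h i k : (i < h)%N -> (k < v)%N -> (i * v + k < h * v)%N.
Proof.
move=> ih kv; apply: (@leq_trans (i.+1 * v)); first by rewrite mulSnr ltn_add2l.
by rewrite leq_mul2r ih orbT.
Qed.

Section StoreMx.
Variables (T : Type) (h v : nat) (d : nat -> T) (a : nat) (M : 'M[T]_(h, v)).

Lemma store_mx_in i j (hi : (i < h)%N) (hj : (j < v)%N) :
  store_mx d a M (a + i * v + j) = M (Ordinal hi) (Ordinal hj).
Proof.
rewrite /store_mx; case: pickP => [[i' j'] /= /eqP|/(_ (Ordinal hi, Ordinal hj))].
  rewrite -!addnA => /addnI /divmod_inj[] //= ei ej.
  by congr (M _ _); apply: val_inj.
by rewrite /= eqxx.
Qed.

Lemma store_mx_out z : (z < a)%N || (a + h * v <= z)%N -> store_mx d a M z = d z.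
Proof.
rewrite /store_mx; case: pickP => [[i j] /= /eqP ->|//].
have := row_lt (ltn_ord i) (ltn_ord j); lia.
Qed.

End StoreMx.

(** * Composition of timed executions *)

Section Reach.
Variables (K : realType) (q : nat) (l : K) (R : pzSemiRingType).
Variables (X : scalar_ext R) (p : program).

(** Phrased through the halting runs of [c'], so that no notion of partial run is required; the
    inequality allows costs to be rounded up. *)
Definition reach (c : config R) (t : K) (c' : config R) : Prop :=
  forall t' c'', run q l X p c' t' c'' ->
  exists2 u, run q l X p c u c'' & u <= t + t'.

Lemma reach_refl c : reach c 0 c.
Proof. by move=> t' c'' r; exists t'; rewrite ?add0r. Qed.

Lemma reach_le c t t' c' : t <= t' -> reach c t c' -> reach c t' c'.
Proof.
move=> tt' h u c'' /h[v r hv]; exists v => //.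
by rewrite (le_trans hv) // lerD2r.
Qed.

Lemma reach_trans c t c' t' c'' :
  reach c t c' -> reach c' t' c'' -> reach c (t + t') c''.
Proof.
move=> h h' u d /h'[v /h[v' r hv'] hv]; exists v' => //.
by rewrite (le_trans hv') // -addrA lerD2l.
Qed.

Lemma reach_step i c c' : onth p (pc c) = Some i -> exec q X i c = Some c' ->
  reach c (cost q l i c) c'.
Proof. by move=> hi he u d r; exists (cost q l i c + u) => //; apply: run_step r. Qed.

Lemma reach_tensor N x y z c h : onth p (pc c) = Some (Tensor N x y z) ->
  words c N = h -> (q <= h)%N ->
  reach c ((h * q)%:R + l) (Config (pc c).+1 (words c)
    (store_mx (scalars c) (words c z)
      (load_mx h q (scalars c) (words c x) *m
       load_mx q q (scalars c) (words c y)))).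
Proof. by move=> hi <- hq; apply: (reach_step hi); rewrite /= hq. Qed.

Lemma reach_words ops k w d :
  word_instrs ops = take (size ops) (drop k p) ->
  reach (Config k w d) (size ops)%:R (Config (k + size ops) (exec_words ops w) d).
Proof.
elim: ops k w => [|[[[o a] x] y] ops IH] k w /= e.
  by rewrite addn0; apply: reach_refl.
have kp : (k < size p)%N.
  by rewrite ltnNge; apply/negP => /drop_oversize h; rewrite h in e.
rewrite (drop_nth (Jump 0) kp) /= in e; case: e => e1 e2.
rewrite -natr1 addrC addnS -addSn; apply: reach_trans (IH _ _ e2).
apply: (@reach_step (WOp o a x y)) => //.
by rewrite /= onthE (nth_map (Jump 0)) // -e1.
Qed.

Lemma reach_loop (I : nat -> (nat -> nat) -> (nat -> R) -> Prop) L E n t w d :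
  (forall k w d, (k < n)%N -> I k w d -> exists w' d', I k.+1 w' d' /\
     reach (Config L w d) t (Config (if (k.+1 < n)%N then L else E) w' d')) ->
  (0 < n)%N -> I 0%N w d ->
  exists w' d', I n w' d' /\ reach (Config L w d) (n%:R * t) (Config E w' d').
Proof.
move=> step n_gt0 hI.
suff main m k w0 d0 : (k + m.+1 = n)%N -> I k w0 d0 -> exists w' d', I n w' d' /\
    reach (Config L w0 d0) (m.+1%:R * t) (Config E w' d').
  by have := main n.-1 0%N w d; rewrite add0n prednK // => h; apply: h.
elim: m k w0 d0 => [|m IH] k w0 d0 e Ik.
  have [|w' [d' [h1 h2]]] := step _ _ _ _ Ik; first by lia.
  exists w', d'; rewrite mul1r; have -> : n = k.+1 by lia.
  by split=> //; move: h2; rewrite ifF //; lia.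
have [|w' [d' [h1]]] := step _ _ _ _ Ik; first by lia.
rewrite ifT; last by lia.
move=> h2; have [|w'' [d'' [h3 h4]]] := IH _ _ _ _ h1; first by lia.
exists w'', d''; split=> //; apply: reach_le (reach_trans h2 h4).
by rewrite -[in X in _ <= X]natr1 mulrDl mul1r addrC.
Qed.

End Reach.

(** Advancing the counter x b + J affects output x alone: the minimum stays b for x' < x, and 0 for
    x' > x by truncated subtraction. *)
Lemma minn_subS b x x' J : (J < b)%N -> x' != x ->
  minn b ((x * b + J).+1 - x' * b) = minn b (x * b + J - x' * b).
Proof.
move=> Jb; rewrite neq_ltn => /orP[] xx.
  have : (x'.+1 * b <= x * b)%N by rewrite leq_mul2r xx orbT.
  by rewrite mulSnr; lia.
have : (x.+1 * b <= x' * b)%N by rewrite leq_mul2r xx orbT.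
by rewrite mulSnr; lia.
Qed.

(** * Symbolic execution and invariants of the three loops *)

Section BlockMul.
Variables (K : realType) (q s : nat) (l : K) (R : pzSemiRingType).
Variable X : scalar_ext R.
Hypotheses (q_gt0 : (0 < q)%N) (q_le_s : (q <= s)%N).

(** Opaque names for the layout, finally instantiated by [erefl]. The b strips of A, of G cells
    each, follow the inputs and the output; then come the strips of B and the partial products. *)
Variables b n G W PA PB PT : nat.
Hypotheses (bE : b = ((s + q - 1) %/ q)%N) (nE : n = (s * s)%N).
Hypotheses (GE : G = (b * (q * q))%N) (WE : W = (b * G)%N).
Hypotheses (PAE : PA = (n + n + n)%N) (PBE : PB = (PA + W)%N) (PTE : PT = (PB + W)%N).

Notation reach := (reach q l X block_mul).

Definition registers (w : nat -> nat) : Prop :=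
  [/\ w 0 = s, w 1 = q, w 2 = b, w 3 = n & w 4 = n + n]%N /\
  [/\ w 5 = PA, w 6 = PB & w 7 = PT]%N /\
  [/\ w 10 = 1, w 11 = G & w 12 = q * q]%N.

(* The address of the entry (i, j) in a zero-padded matrix of b q rows, stored
   as consecutive column strips of width q. *)
Definition enc (i j : nat) : nat := (j %/ q * G + i * q + j %% q)%N.

Definition strip_mem (d : nat -> R) (x : nat) : nat -> R :=
  let o := enc (x %/ s) (x %% s) in
  let d1 := upd d (PA + o) (d x) in upd d1 (PB + o) (d1 (n + x)%N).

Lemma strip_step w d x : registers w -> w 8%N = x ->
  exists w', [/\ registers w', w' 8%N = x.+1 &
    reach (Config 12 w d) 17
      (Config (if (x.+1 < n)%N then 12 else 29) w' (strip_mem d x))].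
Proof.
move=> rw w8; have [[w0 w1 w2 w3 w4] [[w5 w6 w7] [w10 w11 w12]]] := rw.
pose wa := exec_words strip_ops1 w; pose wb := exec_words strip_ops2 wa.
pose wc := exec_words incr_ops wb.
(* The code forms remainders by subtraction; after [subn_divn] both sides agree by computation. *)
have a13 : wa 13%N = enc (x %/ s) (x %% s).
  by rewrite /enc -!subn_divn -w0 -w1 -w11 -w8.
have a14 : wa 14%N = (PA + enc (x %/ s) (x %% s))%N by rewrite -a13 -w5.
have b14 : wb 14%N = (PB + enc (x %/ s) (x %% s))%N by rewrite -a13 -w6.
have b15 : wb 15%N = (n + x)%N by rewrite -w3 -w8.
have c8 : wc 8%N = x.+1.
  by transitivity (w 8 + w 10)%N; rewrite // w8 w10 addn1.
exists wc; split=> //.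
apply: reach_le; last first.
  apply: reach_trans; first by apply: (@reach_words _ _ _ _ _ _ strip_ops1).
  apply: reach_trans; first by apply: reach_step.
  apply: reach_trans; first by apply: (@reach_words _ _ _ _ _ _ strip_ops2).
  apply: reach_trans; first by apply: reach_step.
  apply: reach_trans; first by apply: (@reach_words _ _ _ _ _ _ incr_ops).
  have -> : Config (if (x.+1 < n)%N then 12%N else 29%N) wc (strip_mem d x) =
     Config (if (wc 8 < wc 3)%N then 12 else 29)%N wc
      (upd (upd d (wa 14%N) (d (wa 8%N))) (wb 14%N)
         (upd d (wa 14%N) (d (wa 8%N)) (wb 15%N))).
    rewrite c8 a14 b14 b15; have -> : wc 3%N = n by rewrite -w3.
    by have -> : wa 8%N = x by rewrite -w8.
  by apply: reach_step.
rewrite /=; lra.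
Qed.

Definition tensor_mem (d : nat -> R) (y : nat) : nat -> R :=
  store_mx d (PT + y * G)
    (load_mx s q d (PA + y %/ b * G) *m
     load_mx q q d (PB + (y %% b * G + y %/ b * (q * q)))).

Lemma tensor_step w d y e : registers w -> w 8%N = y -> w 9%N = e ->
  exists w', [/\ registers w', w' 8%N = y.+1, w' 9%N = e &
    reach (Config 31 w d) (13 + (s * q)%:R + l)
      (Config (if (y.+1 < e)%N then 31 else 45) w' (tensor_mem d y))].
Proof.
move=> rw w8 w9; have [[w0 w1 w2 w3 w4] [[w5 w6 w7] [w10 w11 w12]]] := rw.
pose wa := exec_words tensor_ops w; pose wb := exec_words incr_ops wa.
have a0 : wa 0%N = s by rewrite -w0.
have a14 : wa 14%N = (PB + (y %% b * G + y %/ b * (q * q)))%N.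
  by rewrite -subn_divn -w2 -w6 -w8 -w11 -w12.
have a15 : wa 15%N = (PA + y %/ b * G)%N by rewrite -w2 -w5 -w8 -w11.
have a16 : wa 16%N = (PT + y * G)%N by rewrite -w7 -w8 -w11.
have b8 : wb 8%N = y.+1.
  by transitivity (w 8 + w 10)%N; rewrite // w8 w10 addn1.
exists wb; split=> //.
apply: reach_le; last first.
  apply: reach_trans; first by apply: (@reach_words _ _ _ _ _ _ tensor_ops).
  apply: reach_trans; first by apply: reach_tensor; [|exact: a0|].
  apply: reach_trans; first by apply: (@reach_words _ _ _ _ _ _ incr_ops).
  have -> : Config (if (y.+1 < e)%N then 31%N else 45%N) wb (tensor_mem d y) =
     Config (if (wb 8 < wb 9)%N then 31 else 45)%N wb
      (store_mx d (wa 16%N) (load_mx s q d (wa 15%N) *m load_mx q q d (wa 14%N))).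
    by rewrite b8 a14 a15 a16; have -> : wb 9%N = e by rewrite -w9.
  by apply: reach_step.
rewrite /=; lra.
Qed.

Definition sum_mem (d : nat -> R) (y : nat) : nat -> R :=
  let x := (y %/ b)%N in
  upd d (n + n + x) (d (n + n + x)%N +
    d (PT + ((y %% b * b + x %% s %/ q) * G + x %/ s * q + x %% s %% q))%N).

Lemma sum_step w d y e : registers w -> w 8%N = y -> w 9%N = e ->
  exists w', [/\ registers w', w' 8%N = y.+1, w' 9%N = e &
    reach (Config 47 w d) 20
      (Config (if (y.+1 < e)%N then 47 else 67) w' (sum_mem d y))].
Proof.
move=> rw w8 w9; have [[w0 w1 w2 w3 w4] [[w5 w6 w7] [w10 w11 w12]]] := rw.
pose wa := exec_words sum_ops w; pose wb := exec_words incr_ops wa.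
have a13 : wa 13%N = (n + n + y %/ b)%N by rewrite -w2 -w4 -w8.
have a14 : wa 14%N = (PT + ((y %% b * b + (y %/ b) %% s %/ q) * G +
    (y %/ b) %/ s * q + (y %/ b) %% s %% q))%N.
  by rewrite -!subn_divn -w0 -w1 -w2 -w7 -w8 -w11.
have b8 : wb 8%N = y.+1.
  by transitivity (w 8 + w 10)%N; rewrite // w8 w10 addn1.
exists wb; split=> //.
apply: reach_le; last first.
  apply: reach_trans; first by apply: (@reach_words _ _ _ _ _ _ sum_ops).
  apply: reach_trans; first by apply: reach_step.
  apply: reach_trans; first by apply: (@reach_words _ _ _ _ _ _ incr_ops).
  have -> : Config (if (y.+1 < e)%N then 47%N else 67%N) wb (sum_mem d y) =
     Config (if (wb 8 < wb 9)%N then 47 else 67)%N wb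
      (upd d (wa 13%N) (d (wa 13%N) + d (wa 14%N))).
    by rewrite b8 a13 a14; have -> : wb 9%N = e by rewrite -w9.
  by apply: reach_step.
rewrite /=; lra.
Qed.

Lemma setup_steps (A B : 'M[R]_s) : exists w, [/\ registers w, w 8%N = 0%N &
  reach (init_config q A B) 12 (Config 12 w (scalars (init_config q A B)))].
Proof.
pose c := init_config q A B; pose w := upd (words c) 10 1.
exists (exec_words setup_ops w); split=> //.
  by rewrite /registers PTE PBE PAE WE GE nE bE.
apply: reach_le; last first.
  apply: reach_trans; first by apply: reach_step.
  by apply: (@reach_words _ _ _ _ _ _ setup_ops 1).
rewrite /=; lra.
Qed.

(** The condition on [a] keeps the factor [w a] from being reset together with register 8. *)
Lemma reset_steps k a w d (w' := upd (upd w 8 0) 9 (w a * w 2)%N) :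
  a != 8%N -> onth block_mul k = Some (WConst 8 0) ->
  onth block_mul k.+1 = Some (WOp WMul 9 a 2) -> registers w ->
  [/\ registers w', w' 8%N = 0%N, w' 9%N = (w a * w 2)%N &
    reach (Config k w d) 2 (Config k.+2 w' d)].
Proof.
move=> a8 h1 h2 rw; split=> //.
apply: reach_le; last first.
  apply: reach_trans; first by apply: (reach_step _ (i := WConst 8 0)).
  by apply: (reach_step _ (i := WOp WMul 9 a 2)); rewrite //= /w' /upd (negbTE a8).
rewrite /=; lra.
Qed.

Lemma s_gt0 : (0 < s)%N. Proof. exact: leq_trans q_gt0 q_le_s. Qed.

Lemma s_le_bq : (s <= b * q)%N.
Proof.
have := divn_eq (s + q - 1) q; have := ltn_pmod (s + q - 1) q_gt0.
rewrite -bE; lia.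
Qed.

(** Since b q <= s + q - 1 and q <= s, padding at most doubles the side. *)
Lemma bq_le_2s : (b * q <= 2 * s)%N.
Proof. by have := leq_trunc_div (s + q - 1) q; rewrite -bE; lia. Qed.

Lemma b_gt0 : (0 < b)%N.
Proof. by have := s_le_bq; have := s_gt0; nia. Qed.

Lemma n_gt0 : (0 < n)%N. Proof. by rewrite nE muln_gt0 s_gt0. Qed.

Lemma strip_sizeE : G = (b * q * q)%N. Proof. by rewrite GE mulnA. Qed.

Lemma enc_lt i j : (i < b * q)%N -> (j < b * q)%N -> (enc i j < W)%N.
Proof.
move=> ib jb; have h1 : (j %/ q < b)%N by rewrite ltn_divLR.
by rewrite WE /enc -addnA row_lt // strip_sizeE row_lt ?ltn_pmod.
Qed.

(** [enc] is a mixed-radix numeral with digits j / q, i and j mod q. *)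
Lemma enc_inj i j i' j' : (i < b * q)%N -> (i' < b * q)%N ->
  enc i j = enc i' j' -> i = i' /\ j = j'.
Proof.
move=> ib ib' e; have jq := ltn_pmod j q_gt0; have jq' := ltn_pmod j' q_gt0.
move: e; rewrite /enc -!addnA => /divmod_inj[]; rewrite ?strip_sizeE ?row_lt // => eJ.
by move=> /(divmod_inj jq jq')[-> eR]; rewrite (divn_eq j q) (divn_eq j' q) eJ eR.
Qed.

Lemma enc_block i J k : (k < q)%N -> enc i (J * q + k) = (J * G + i * q + k)%N.
Proof. by move=> kq; rewrite /enc divnMDl // divn_small // addn0 modnMDl modn_small. Qed.

Variable d0 : nat -> R.
Hypothesis d0_out : forall z, (n + n <= z)%N -> d0 z = 0.

Definition pad (a i j : nat) : R :=
  if (i < s)%N && (j < s)%N then d0 (a + (i * s + j))%N else 0.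

Definition strips_upto (x : nat) (d : nat -> R) : Prop :=
  [/\ forall z, (z < PA)%N -> d z = d0 z,
      forall i j, (i < b * q)%N -> (j < b * q)%N ->
        d (PA + enc i j)%N = if (i * s + j < x)%N then pad 0 i j else 0 &
      forall i j, (i < b * q)%N -> (j < b * q)%N ->
        d (PB + enc i j)%N = if (i * s + j < x)%N then pad n i j else 0].

Lemma strips_upto0 : strips_upto 0 d0.
Proof. by split=> // i j ib jb; rewrite d0_out //; lia. Qed.

Lemma pad_upd a i j x : (x < n)%N -> (if (i * s + j < x.+1)%N then pad a i j else 0) =
  if (i == x %/ s)%N && (j == x %% s)%N then d0 (a + x)%N
  else if (i * s + j < x)%N then pad a i j else 0.
Proof.
move=> xn; have xs := ltn_pmod x s_gt0.
case: (boolP (_ && _)) => [/andP[/eqP -> /eqP ->]|h].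
  by rewrite -divn_eq ltnSn /pad xs -divn_eq ltn_divLR ?s_gt0 // -nE xn.
case: (ltngtP (i * s + j) x) => [hx|hx|exy].
- by rewrite ltnS ltnW.
- by rewrite ifF //; lia.
(* Here i s + j = x without being the division of x by s, so (i, j) lies in the padding. *)
rewrite -exy ltnSn /pad; case: ifP => // /andP[i_s js].
move: h; rewrite -exy divnMDl ?s_gt0 // divn_small // addn0 modnMDl.
by rewrite modn_small // !eqxx.
Qed.

Lemma strip_mem_upto x d : (x < n)%N -> strips_upto x d ->
  strips_upto x.+1 (strip_mem d x).
Proof.
move=> xn [h1 h2 h3].
set i := (x %/ s)%N; set j := (x %% s)%N.
have i_s : (i < s)%N by rewrite ltn_divLR ?s_gt0 -?nE.
have js : (j < s)%N by rewrite ltn_pmod ?s_gt0.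
have sb := s_le_bq.
have ib : (i < b * q)%N by apply: leq_trans sb.
have jb : (j < b * q)%N by apply: leq_trans sb.
have eb := enc_lt ib jb.
have encE i' j' : (i' < b * q)%N -> (enc i' j' == enc i j) = (i' == i) && (j' == j).
  move=> ib'; apply/eqP/andP => [/(enc_inj ib' ib)[-> ->]|]; first by [].
  by case=> /eqP-> /eqP->.
rewrite /strip_mem -/i -/j /upd; split.
- move=> z zA; rewrite ifF; last by lia.
  by rewrite ifF ?h1 //; lia.
- move=> i' j' ib' jb'; have eb' := enc_lt ib' jb'.
  rewrite ifF; last by lia.
  rewrite eqn_add2l encE // pad_upd // -/i -/j.
  by case: ifP => _; [rewrite h1 //; lia | rewrite h2].
- move=> i' j' ib' jb'; rewrite eqn_add2l encE // pad_upd // -/i -/j.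
  case: ifP => _; first by rewrite ifF ?h1 //; lia.
  by rewrite ifF ?h3 //; lia.
Qed.

Definition part (J k r c : nat) : R :=
  \sum_(i < q) pad 0 r (J * q + i) * pad n (J * q + i) (k * q + c).

(** The first clause keeps the output cells at 0, from which the last loop accumulates. *)
Definition parts_upto (y : nat) (d : nat -> R) : Prop :=
  [/\ forall z, (n + n <= z < PA)%N -> d z = 0,
      forall i j, (i < b * q)%N -> (j < b * q)%N ->
        d (PA + enc i j)%N = pad 0 i j,
      forall i j, (i < b * q)%N -> (j < b * q)%N ->
        d (PB + enc i j)%N = pad n i j &
      forall y' r c, (y' < y)%N -> (r < s)%N -> (c < q)%N ->
        d (PT + (y' * G + r * q + c))%N = part (y' %/ b) (y' %% b) r c].

Lemma pad_upto a i j : (if (i * s + j < n)%N then pad a i j else 0) = pad a i j.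
Proof.
rewrite /pad; case: (boolP (_ && _)) => [/andP[i_s js]|_]; last by case: ifP.
by rewrite ifT // nE row_lt.
Qed.

Lemma parts_upto0 d : strips_upto n d -> parts_upto 0 d.
Proof.
move=> [h1 h2 h3]; split=> //.
- by move=> z /andP[z1 z2]; rewrite h1 // d0_out.
- by move=> i j ib jb; rewrite h2 // pad_upto.
- by move=> i j ib jb; rewrite h3 // pad_upto.
Qed.

Lemma tensor_mem_upto y d : (y < b * b)%N -> parts_upto y d ->
  parts_upto y.+1 (tensor_mem d y).
Proof.
move=> yb [h1 h2 h3 h4].
have Jb : (y %/ b < b)%N by rewrite ltn_divLR ?b_gt0.
have kb : (y %% b < b)%N by rewrite ltn_pmod ?b_gt0.
(* An s x q result fits in a slot of G cells, so earlier slots stay intact. *)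
have sG : (s * q <= G)%N by rewrite strip_sizeE leq_mul2r s_le_bq orbT.
have old z : (z < PT + y * G)%N -> tensor_mem d y z = d z.
  by move=> hz; rewrite /tensor_mem store_mx_out // hz.
split.
- by move=> z hz; rewrite old ?h1 //; lia.
- by move=> i j ib jb; have := enc_lt ib jb => eb; rewrite old ?h2 //; lia.
- by move=> i j ib jb; have := enc_lt ib jb => eb; rewrite old ?h3 //; lia.
move=> y' r c; rewrite ltnS leq_eqVlt => /orP[/eqP->|yy] rs cq; last first.
  rewrite old ?h4 // ltn_add2l -addnA.
  apply: (@leq_trans (y'.+1 * G)); last by rewrite leq_mul2r yy orbT.
  by rewrite mulSnr ltn_add2l (leq_trans _ sG) // row_lt.
rewrite /tensor_mem !addnA store_mx_in mxE /part; apply: eq_bigr => i _.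
have iq := ltn_ord i; rewrite !mxE /=; congr (_ * _).
- rewrite -h2 ?enc_block ?addnA //; first exact: leq_trans s_le_bq.
  exact: row_lt.
- rewrite -h3 ?enc_block //; try exact: row_lt.
  by congr (d _); rewrite mulnDl; lia.
Qed.

Definition psum (x m : nat) : R :=
  \sum_(J < m) part J (x %% s %/ q) (x %/ s) (x %% s %% q).

(** Outputs are completed one after the other, b summands each: the truncated difference is 0 before
    the turn of x, and the cap b applies after it. *)
Definition sums_upto (y : nat) (d : nat -> R) : Prop :=
  (forall y' r c, (y' < b * b)%N -> (r < s)%N -> (c < q)%N ->
     d (PT + (y' * G + r * q + c))%N = part (y' %/ b) (y' %% b) r c) /\
  (forall x, (x < n)%N -> d (n + n + x)%N = psum x (minn b (y - x * b))).

Lemma sums_upto0 d : parts_upto (b * b) d -> sums_upto 0 d.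
Proof.
move=> [h1 _ _ h4]; split=> // x xn.
by rewrite sub0n minn0 /psum big_ord0 h1 //; lia.
Qed.

Lemma sum_mem_upto y d : (y < n * b)%N -> sums_upto y d ->
  sums_upto y.+1 (sum_mem d y).
Proof.
move=> yn [h1 h2]; have b0 := b_gt0.
set x := (y %/ b)%N; set J := (y %% b)%N.
have ey : y = (x * b + J)%N := divn_eq y b.
have xn : (x < n)%N by rewrite ltn_divLR.
have Jb : (J < b)%N by rewrite ltn_pmod.
have kb : (x %% s %/ q < b)%N.
  by rewrite ltn_divLR // (leq_trans _ s_le_bq) // ltn_pmod ?s_gt0.
split.
  move=> y' r c hy hr hc; rewrite /sum_mem /upd ifF ?h1 //.
  by rewrite -/x; clearbody x; clear -xn PTE PBE PAE; lia.
move=> x' xn'; rewrite /sum_mem /upd -/x -/J eqn_add2l.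
case: (_ =P _) => [->|/eqP xx].
  have -> : minn b (y.+1 - x * b) = J.+1.
    by rewrite [in LHS]ey -addnS addKn; apply/minn_idPr.
  rewrite /psum big_ord_recr /=; congr (_ + _).
    rewrite h2 // /psum; suff -> : minn b (y - x * b) = J by [].
    by rewrite [in LHS]ey addKn; apply/minn_idPr/ltnW.
  rewrite h1.
  - by rewrite divnMDl // divn_small // addn0 modnMDl modn_small.
  - exact: row_lt.
  - by rewrite ltn_divLR ?s_gt0 -?nE.
  - by rewrite ltn_pmod.
by rewrite h2 // [in X in _ = psum _ X]ey minn_subS // -ey.
Qed.

Lemma sum_blocks (F : nat -> R) m :
  \sum_(J < m) \sum_(i < q) F (J * q + i)%N = \sum_(j < m * q) F j.
Proof.
elim: m => [|m IH]; first by rewrite !big_ord0.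
by rewrite big_ord_recr /= IH mulSnr big_split_ord.
Qed.

Lemma psumE x : (x < n)%N ->
  psum x b = \sum_(j < s) d0 (x %/ s * s + j)%N * d0 (n + (j * s + x %% s))%N.
Proof.
move=> xn; rewrite /psum /part -divn_eq.
rewrite (sum_blocks (fun j => pad 0 (x %/ s) j * pad n j (x %% s))).
have xs : (x %/ s < s)%N by rewrite ltn_divLR ?s_gt0 -?nE.
have xs' : (x %% s < s)%N by rewrite ltn_pmod ?s_gt0.
(* The b q indices are cut at s; those beyond fall in the padding of A. *)
rewrite -(subnKC s_le_bq) big_split_ord /= [X in _ + X]big1 ?addr0.
  by apply: eq_bigr => j _; rewrite /pad xs xs' ltn_ord.
by move=> j _; rewrite /pad xs ltnNge leq_addr mul0r.
Qed.

Lemma loops_reach w : registers w -> w 8%N = 0%N ->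
  exists w' d', (forall x, (x < n)%N -> d' (n + n + x)%N = psum x b) /\
    reach (Config 12 w d0)
      (n%:R * 17 + 2 + (b * b)%:R * (13 + (s * q)%:R + l) + 2 + (n * b)%:R * 20)
      (Config 67 w' d').
Proof.
move=> rw w8; have b0 := b_gt0; have n0 := n_gt0.
have [|//||w1 [d1 [[rw1 _ m1] r1]]] := @reach_loop K q l R X block_mul
    (fun k w d => [/\ registers w, w 8%N = k & strips_upto k d]) 12 29 n 17 w d0.
- move=> k w' d kn [rw' w8' m]; have [w'' [h1 h2 h3]] := strip_step d rw' w8'.
  by exists w'', (strip_mem d k); split=> //; split=> //; apply: strip_mem_upto.
- by split=> //; apply: strips_upto0.
have [rw2 w28 w29 r2] := @reset_steps 29 2 w1 d1 isT erefl erefl rw1.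
have e1 : (w1 2 * w1 2 = b * b)%N by case: rw1 => -[_ _ -> _ _].
(* The word bank is generalized: only its recorded registers matter from here on. *)
rewrite e1 in rw2 w28 w29 r2; move: (upd (upd w1 8 0) 9 (b * b)) rw2 w28 w29 r2.
move=> w2 rw2 w28 w29 r2.
have [|||w3 [d3 [[rw3 _ _ m3] r3]]] := @reach_loop K q l R X block_mul
    (fun k w d => [/\ registers w, w 8%N = k, w 9%N = (b * b)%N & parts_upto k d])
    31 45 (b * b) (13 + (s * q)%:R + l) w2 d1.
- move=> k w' d kn [rw' w8' w9' m]; have [w'' [h1 h2 h3 h4]] := tensor_step d rw' w8' w9'.
  by exists w'', (tensor_mem d k); split=> //; split=> //; apply: tensor_mem_upto.
- by rewrite muln_gt0 b0.
- by split=> //; apply: parts_upto0.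
have [rw4 w48 w49 r4] := @reset_steps 45 3 w3 d3 isT erefl erefl rw3.
have e3 : (w3 3 * w3 2 = n * b)%N by case: rw3 => -[_ _ -> -> _].
rewrite e3 in rw4 w48 w49 r4; move: (upd (upd w3 8 0) 9 (n * b)) rw4 w48 w49 r4.
move=> w4 rw4 w48 w49 r4.
have [|||w5 [d5 [[_ _ _ [_ m5]] r5]]] := @reach_loop K q l R X block_mul
    (fun k w d => [/\ registers w, w 8%N = k, w 9%N = (n * b)%N & sums_upto k d])
    47 67 (n * b) 20 w4 d3.
- move=> k w' d kn [rw' w8' w9' m]; have [w'' [h1 h2 h3 h4]] := sum_step d rw' w8' w9'.
  by exists w'', (sum_mem d k); split=> //; split=> //; apply: sum_mem_upto.
- by rewrite muln_gt0 n0.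
- by split=> //; apply: sums_upto0.
exists w5, d5; split.
  (* At the end y = n b, so at least b summands are due for every x < n. *)
  move=> x xn; rewrite m5 //; congr psum; apply/minn_idPl.
  by rewrite -mulnBl leq_pmull // subn_gt0.
exact: (reach_trans (reach_trans (reach_trans (reach_trans r1 r2) r3) r4) r5).
Qed.

End BlockMul.

(** * Total time and correctness of the blocked algorithm *)

Lemma block_mul_time (K : realType) (q s b : nat) (l : K) : (0 < q)%N -> (q <= s)%N ->
  (b * q <= 2 * s)%N -> 0 <= l ->
  12 + ((s * s)%:R * 17 + 2 + (b * b)%:R * (13 + (s * q)%:R + l) + 2 +
    (s * s * b)%:R * 20) <= 150 * tcu_bound (s ^ 2) (q ^ 2) l.
Proof.
move=> q0 qs bq l0; rewrite tcu_boundE // natrX natrX natrX !natrM.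
have {}q0 : 1 <= q%:R :> K by rewrite ler1n.
have {}qs : q%:R <= s%:R :> K by rewrite ler_nat.
have {}bq : b%:R * q%:R <= 2 * s%:R :> K by rewrite -!natrM ler_nat.
have b0 : 0 <= b%:R :> K by [].
move: (q%:R : K) (s%:R : K) (b%:R : K) q0 qs bq b0 => Q S B Q1 QS BQ B0.
have Q0 : 0 < Q by lra.
have S1 : 1 <= S by lra.
(* In terms of r = s / q the two summands of the bound are s^2 r and r^2 l, and b <= 2 r. *)
pose r := S / Q; have rE : S = r * Q by rewrite /r divfK // gt_eqF.
have r1 : 1 <= r by rewrite ler_pdivlMr // mul1r.
have Br : B <= 2 * r by rewrite -(ler_pM2r Q0) -mulrA -rE.
have -> : S ^+ 3 / Q = S * S * r by rewrite /r; field; rewrite gt_eqF.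
have -> : S ^+ 2 / Q ^+ 2 * l = r * r * l by rewrite /r; field; rewrite gt_eqF.
clearbody r.
have BB : B * B <= 4 * (r * r).
  by have := ler_pM B0 B0 Br Br; lra.
have SS : 1 <= S * S by nra.
have h1 : S * S <= S * S * r by rewrite ler_peMr //; lra.
have h2 : B * B * l <= 4 * (r * r * l) by rewrite mulrA ler_wpM2r.
have SQ1 : 1 <= S * Q by nra.
have h3 : B * B * (S * Q) <= 4 * (S * S * r).
  have -> : 4 * (S * S * r) = 4 * (r * r) * (S * Q) by ring: rE.
  by rewrite ler_wpM2r //; lra.
have h4 : B * B <= B * B * (S * Q) by rewrite ler_peMr // mulr_ge0.
have h5 : S * S * B <= 2 * (S * S * r).
  have -> : 2 * (S * S * r) = S * S * (2 * r) by ring.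
  by rewrite ler_wpM2l //; lra.
have h6 : 0 <= r * r * l by rewrite !mulr_ge0 //; lra.
(* The coefficients add up to 129 on s^2 r and 4 on r^2 l, within 150. *)
lra.
Qed.

Lemma block_mul_multiplies (K : realType) (q s : nat) (l : K) (R : pzSemiRingType)
    (X : scalar_ext R) (A B : 'M[R]_s) :
  (0 < q)%N -> (q <= s)%N -> 0 <= l ->
  exists2 t, multiplies_in q l X block_mul A B t &
    t <= 150 * tcu_bound (s ^ 2) (q ^ 2) l.
Proof.
move=> q0 qs l0; set c0 := init_config q A B.
have n2 : (s ^ 2 = s * s)%N by rewrite mulnn.
have s0 : (0 < s)%N by apply: leq_trans qs.
have dA i j (hi : (i < s)%N) (hj : (j < s)%N) :
    scalars c0 (i * s + j)%N = A (Ordinal hi) (Ordinal hj).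
  have hij : (i * s + j < s * s)%N by apply: row_lt.
  rewrite /c0 /= store_mx_out ?n2 ?hij //.
  by rewrite -[(i * s)%N]add0n store_mx_in.
have dB i j (hi : (i < s)%N) (hj : (j < s)%N) :
    scalars c0 (s * s + (i * s + j))%N = B (Ordinal hi) (Ordinal hj).
  by rewrite /c0 /= n2 addnA store_mx_in.
have d_out z : (s * s + s * s <= z)%N -> scalars c0 z = 0.
  move=> hz; rewrite /c0 /= n2 store_mx_out; last by rewrite hz orbT.
  by rewrite store_mx_out //; lia.
have [w [rw w8 r1]] := @setup_steps K q s l R X _ _ _ _ _ _ _ erefl erefl erefl
  erefl erefl erefl erefl A B.
have [w' [d' [hd r2]]] := @loops_reach K q s l R X q0 qs _ _ _ _ _ _ _ erefl erefl erefl
  erefl erefl erefl erefl _ d_out _ rw w8.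
have halt : run q l X block_mul (Config 67 w' d') 0 (Config 67 w' d') by apply: run_halt.
have [t rt ht] := reach_trans r1 r2 halt.
exists t; last first.
  rewrite addr0 in ht; apply: le_trans ht _; apply: block_mul_time => //.
  exact: bq_le_2s.
exists (Config 67 w' d') => //; apply/matrixP => i j; rewrite !mxE /=.
have ijn : (i * s + j < s * s)%N by apply: row_lt.
have -> : (2 * s ^ 2 + i * s + j = s * s + s * s + (i * s + j))%N.
  by rewrite n2 mul2n -addnn !addnA.
rewrite hd // (psumE q0 qs erefl erefl erefl erefl erefl erefl erefl) //.
have -> : ((i * s + j) %/ s = i)%N by rewrite divnMDl // divn_small // addn0.
have -> : ((i * s + j) %% s = j)%N by rewrite modnMDl modn_small.
apply: eq_bigr => k _; rewrite (dA _ _ (ltn_ord i) (ltn_ord k)).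
rewrite (dB _ _ (ltn_ord k) (ltn_ord j)).
by congr (A _ _ * B _ _); apply: val_inj.
Qed.

Theorem theorem2 (K : realType) :
  (exists (p : program) (c1 c2 : K),
    [/\ 0 < c1, 0 < c2, semiring_only p, tensor_products_only p &
      forall (q s : nat) (l : K), (0 < q)%N -> (q <= s)%N -> 0 <= l ->
      forall (R : pzSemiRingType) (X : scalar_ext R) (A B : 'M[R]_s),
      exists t : K, multiplies_in q l X p A B t /\
        c1 * tcu_bound (s ^ 2) (q ^ 2) l <= t
          <= c2 * tcu_bound (s ^ 2) (q ^ 2) l])
  /\
  (exists c : K, 0 < c /\
    forall (q s : nat) (l : K), (0 < q)%N -> 0 <= l ->
    forall (R : pzSemiRingType) (X : scalar_ext R) (p : program),
    injective (fun k : nat => k%:R : R) ->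
    semiring_only p ->
    tensor_products_only p \/ l <= (q ^ 2)%:R * Num.sqrt (s ^ 2)%:R ->
    multiplies q l X p s ->
    forall (A B : 'M[R]_s) (t : K), multiplies_in q l X p A B t ->
      c * tcu_bound (s ^ 2) (q ^ 2) l <= t).
Proof.
have half_gt0 : 0 < 2^-1 :> K by rewrite invr_gt0.
split; last first.
  exists 2^-1; split=> // q s l q0 l0 R X p natr_inj sp hl mp A B t.
  exact: tcu_lower_bound.
(* The constants are those of [tcu_lower_bound] and [block_mul_time]. *)
exists block_mul, 2^-1, 150; split=> // q s l q0 qs l0 R X A B.
have [t mt tle] := block_mul_multiplies X A B q0 qs l0.
exists t; split=> //; rewrite tle andbT.
(* The running time is the same over every semiring, so it can be bounded over nat. *)
have mN : multiplies q l (trivial_ext nat) block_mul s.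
  move=> A' B'.
  by have [u mu _] := block_mul_multiplies (trivial_ext nat) A' B' q0 qs l0; exists u.
have [u [c' rN hN]] := mN 0 0; have [c rR _] := mt.
have [||||//|//|e _ rN'] := run_init_rel (rel := fun _ _ => True)
  (A' := 0 : 'M[nat]_s) (B' := 0) (trivial_ext nat) _ _ _ _
  (isT : semiring_only block_mul) _ _ rR; rewrite //.
have [<- ec] := run_inj rN rN'.
apply: (tcu_lower_bound q0 l0 _ _ mN (A := 0) (B := 0)) => //.
- by move=> k k'; rewrite !natn.
- by left.
- by exists c'.
Qed.
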